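(* Let $(\Omega,\mathcal{A},P)$ be a probability space, $\mathcal{G}\subset\mathcal{A}$ a sub-$\sigma$-field, $(S,d)$ a separable metric space, $(X_n)_{n\ge 0}$ a sequence of $S$-valued random variables on $(\Omega,\mathcal{A},P)$, and $(k_n)_{n\ge 0}$ a sequence of strictly positive real constants with $k_n\to\infty$. Let $U$ be a strictly positive, $\mathcal{G}$-measurable real random variable. Suppose that at least one of the following holds: (1) $U$ is discrete and $\inf_{\delta>0}\limsup_n P\bigl(M_n(\delta)>\epsilon\bigr)=0$ for all $\epsilon>0$; (2) for each $\epsilon>0$ there is $\delta>0$ such that $$\limsup_n P\bigl(M_n(\delta)>\epsilon\mid H\bigr)<\epsilon\quad\text{for all }H\in\mathcal{G}\text{ with }P(H)>0.$$ Then $$\inf_{\delta>0}\limsup_n P\bigl(M_{[k_nU]}(\delta)>\epsilon\bigr)=0\quad\text{for all }\epsilon>0.$$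
   Context: For an integer $n\ge 0$ and $\delta>0$, let $M_n(\delta)=\max_{j:\,|n-j|\le n\delta} d(X_j,X_n)$, the maximum being over integers $j\ge 0$. $M_{[k_nU]}(\delta)$ is obtained by evaluating at the random index $[k_nU]$, i.e. $M_{[k_nU]}(\delta)=\max_{j:\,|[k_nU]-j|\le [k_nU]\delta} d(X_j,X_{[k_nU]})$, where $[x]$ denotes the integer part of $x$. $P(\cdot\mid H)$ is the conditional probability given the event $H$. A random variable is discrete if it takes values in a countable set almost surely. *)

(* Defs.v *)
From HB Require Import structures.
From mathcomp Require Import all_boot all_order all_algebra.
From mathcomp Require Import all_classical all_reals all_analysis.

Set Implicit Arguments.
Unset Strict Implicit.
Unset Printing Implicit Defensive.

Import Order.TTheory GRing.Theory Num.Theory.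
Import numFieldNormedType.Exports.

Local Open Scope classical_set_scope.
Local Open Scope ring_scope.

Definition separable_space (S : topologicalType) : Prop :=
  exists D : set S, countable D /\ dense D.

(* [measurable_fun] is not used because its codomain must be pointed, and a
   [metricType] need not be. *)
Definition borel_measurable d (T : measurableType d) (S : topologicalType)
    (f : T -> S) : Prop :=
  forall B : set S, <<s [set: S], open >> B -> measurable (f @^-1` B).

Definition sub_sigma_field d (T : measurableType d) (G : set (set T)) : Prop :=
  sigma_algebra [set: T] G /\ G `<=` measurable.

(* [g_sigma_algebraType G] is [T] with the sigma-algebra generated by [G], which
   is [G] itself when [G] is a sigma-algebra ([measurable_g_measurableTypeE]). *)
Definition measurable_wrt d (T : measurableType d) (G : set (set T))
    d' (T' : measurableType d') (f : T -> T') : Prop :=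
  measurable_fun [set: g_sigma_algebraType G] (f : g_sigma_algebraType G -> T').

Definition discrete_rv d (T : measurableType d) (R : realType)
    (P : probability T R) (U : T -> R) : Prop :=
  exists C : set R, countable C /\ {ae P, forall w, C (U w)}.

Definition cond_prob d (T : measurableType d) (R : realType)
    (P : probability T R) (A H : set T) : \bar R :=
  (P (A `&` H) / P H)%E.

(* max of d(x_j, x_n) over the j >= 0 with |n - j| <= n * delta; the bound on
   the range of j is implied by this condition, and the default value 0 is
   harmless since j = n satisfies it. *)
Definition maxdist (R : realType) (S : metricType R) (x : nat -> S) (n : nat)
    (delta : R) : R :=
  \big[Num.max/0]_(j < (Num.truncn (n%:R * (1 + delta))).+1
                   | `|n%:R - j%:R| <= n%:R * delta) mdist (x j) (x n).

Lemma maxdist_ub (R : realType) (S : metricType R) (x : nat -> S) (n : nat)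
    (delta : R) (j : nat) :
  `|n%:R - j%:R| <= n%:R * delta -> mdist (x j) (x n) <= maxdist x n delta.
Proof.
move=> jn.
have jlt : (j < (Num.truncn (n%:R * (1 + delta))).+1)%N.
  have le_jn : j%:R <= n%:R * (1 + delta).
    by rewrite mulrDr mulr1 -lerBlDl (le_trans _ jn)// distrC ler_norm.
  by rewrite ltnS -(@natrK R j) le_truncn.
exact: (le_bigmax_cond 0 (j := Ordinal jlt)
  (fun i : 'I__ => mdist (x i) (x n)) jn).
Qed.

Lemma maxdist_attained (R : realType) (S : metricType R) (x : nat -> S)
    (n : nat) (delta : R) : 0 < delta ->
  exists2 j : nat, `|n%:R - j%:R| <= n%:R * delta
                 & maxdist x n delta = mdist (x j) (x n).
Proof.
move=> delta0; rewrite /maxdist.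
apply: (big_ind (fun m => exists2 j : nat, `|n%:R - j%:R| <= n%:R * delta
                                          & m = mdist (x j) (x n))).
- by exists n; rewrite ?subrr ?normr0 ?mulr_ge0 ?(ltW delta0)// mdistxx.
- move=> _ _ [i hi ->] [j hj ->].
  by case: leP => _; [exists j|exists i].
- by move=> j hj; exists j.
Qed.

(* Main.v *)
Require Import Defs.
From HB Require Import structures.
From mathcomp Require Import all_boot all_order all_algebra.
From mathcomp Require Import all_classical all_reals all_analysis.
From mathcomp Require Import lra.

(** Up to an event of small probability, [Omega] is covered by finitely many
    events [H i], in the sigma-field of [U], on each of which [U] is (nearly) a
    constant [u i].  Under (1), [H i = {U = u i}], so on [H i] the random index is
    the deterministic index [[k_n u_i]] and the hypothesis is used along this
    subsequence.  Under (2), [U] varies on [H i] by a factor less than [1 + t];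
    then [[k_n U]] and its [t]-window lie in the [delta]-window of [[k_n u_i]], so
    that [M_[k_n U](t) <= 2 M_[k_n u_i](delta)] for large [n], and the bound on
    the conditional probabilities given [H i] applies. *)

Set Implicit Arguments.
Unset Strict Implicit.

Import Order.TTheory GRing.Theory Num.Theory.
Import numFieldNormedType.Exports.

Local Open Scope classical_set_scope.
Local Open Scope ring_scope.

(** * Limits superior and deterministic index subsequences *)

Lemma limn_esup_lt_near (R : realType) (v : nat -> \bar R) (e : \bar R) :
  (limn_esup v < e)%E -> \forall n \near \oo, (v n < e)%E.
Proof.
rewrite /limn_esup limf_esupE => /ereal_inf_lt[_ [A FA <-] lt_e].
apply: filterS FA => n An; apply: le_lt_trans lt_e.
by apply: ereal_sup_ubound; exists n.
Qed.

Lemma limn_esup_le_near (R : realType) (v : nat -> \bar R) (e : \bar R) :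
  (\forall n \near \oo, (v n <= e)%E) -> (limn_esup v <= e)%E.
Proof.
move=> vle; rewrite /limn_esup limf_esupE; apply: ge_ereal_inf.
exists (ereal_sup (v @` [set n | (v n <= e)%E])); first by exists [set n | (v n <= e)%E].
by apply: ge_ereal_sup => _ [n ? <-].
Qed.

(** Since $k_n u \to \infty$, the indices $[k_n u]$ eventually pass any bound, so an eventual
    property of $n$ transfers to $[k_n u]$. *)
Lemma near_truncn_scaled (R : realType) (k : nat -> R) (u : R) (Q : nat -> Prop) :
  k n @[n --> \oo] --> +oo -> 0 < u ->
  (\forall n \near \oo, Q n) -> \forall n \near \oo, Q (Num.truncn (k n * u)).
Proof.
move=> /cvgryPge kinf u0 [N _ NQ]; have := kinf (N%:R / u).
apply: filterS => n; rewrite ler_pdivrMr// => le_N.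
by apply: NQ => /=; rewrite -(@natrK R N) le_truncn.
Qed.

(** * Measurability of the events $M_N(\delta) > e$ *)

Lemma mdist_ball_open (R : realType) (S : metricType R) (q : S) (r : R) :
  open [set b | mdist q b < r].
Proof.
rewrite openE => b /= qb; apply/nbhs_ballP.
exists (r - mdist q b); first by rewrite /= subr_gt0.
move=> c; rewrite ballEmdist /= => bc.
by rewrite (le_lt_trans (metric_triangle q b c))// -ltrBrDl.
Qed.

Lemma mdist_gt_open (R : realType) (S : metricType R) (q : S) (r : R) :
  open [set b | r < mdist q b].
Proof.
rewrite openE => b /= qb; apply/nbhs_ballP.
exists (mdist q b - r); first by rewrite /= subr_gt0.
move=> c; rewrite ballEmdist /= => bc.
have := metric_triangle q c b; rewrite (metric_sym c b); lra.
Qed.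

Lemma countable_range (T : pointedType) (D : set T) :
  countable D -> exists s : nat -> T, D `<=` range s.
Proof.
move=> /pfcard_geP[->|[s]]; first by exists (fun=> point).
by exists s; exact: (surj (f := s)).
Qed.

Lemma bigcup_countable_measurable d (T : measurableType d) (I : Type) (D : set I)
    (F : I -> set T) :
  countable D -> (forall i, measurable (F i)) -> measurable (\bigcup_(i in D) F i).
Proof.
move=> /pfcard_geP[->|[s]] mF; first by rewrite bigcup_set0.
by rewrite -(image_eq s) bigcup_image; exact: bigcup_measurable.
Qed.

(* By separability, the open set [d > e] of [S * S] is a countable union of
   rectangles [ball q r * {b | e + r < d q b}]. *)
Lemma mdist_gt_measurable d (T : measurableType d) (R : realType)
    (S : metricType R) (X Y : T -> S) (e : R) :
  separable_space S -> borel_measurable X -> borel_measurable Y ->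
  measurable [set w | e < mdist (X w) (Y w)].
Proof.
move=> [D [cD dD]] mX mY.
pose B q m : set T := X @^-1` [set b | mdist q b < m.+1%:R^-1] `&`
                      Y @^-1` [set b | e + m.+1%:R^-1 < mdist q b].
have -> : [set w | e < mdist (X w) (Y w)] = \bigcup_m \bigcup_(q in D) B q m.
  apply/seteqP; split=> w /=.
    move=> lt_e.
    (* With $r$ below half the excess $d(X,Y) - e$, a point $q$ within $r$ of $X$ has $d(q,Y) >
       d(X,Y) - r > e + r$. *)
    have h0 : 0 < (mdist (X w) (Y w) - e) / 2 by lra.
    have [m _ /(_ m (leqnn m)) /= lt_m] := near_infty_natSinv_lt (PosNum h0).
    have r0 : 0 < m.+1%:R^-1 :> R by rewrite invr_gt0.
    have [q [/= Xq Dq]] : [set b | mdist (X w) b < m.+1%:R^-1] `&` D !=set0.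
      apply: dD; last exact: mdist_ball_open.
      by exists (X w); rewrite /= mdistxx.
    exists m => //; exists q => //; split => /=; first by rewrite metric_sym.
    have := metric_triangle (X w) q (Y w).
    by move: (m.+1%:R^-1) lt_m Xq => r; lra.
  move=> [m _ [q Dq [/= Xq Yq]]].
  have := metric_triangle q (X w) (Y w).
  by move: (m.+1%:R^-1) Xq Yq => r; lra.
apply: bigcup_measurable => m _; apply: bigcup_countable_measurable => // q.
by apply: measurableI; [apply: mX|apply: mY]; apply: sub_sigma_algebra;
  [exact: mdist_ball_open|exact: mdist_gt_open].
Qed.

(** A maximum exceeds $e$ exactly when one of its terms does; splitting over the countably many
    values of [N] leaves pairs of deterministic indices. *)
Lemma maxdist_gt_measurable d (T : measurableType d) (R : realType)
    (S : metricType R) (X : nat -> T -> S) (N : T -> nat) (e delta : R) :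
  separable_space S -> (forall n, borel_measurable (X n)) ->
  (forall m, measurable (N @^-1` [set m])) -> 0 < delta ->
  measurable [set w | e < maxdist (X ^~ w) (N w) delta].
Proof.
move=> hS mX mN delta0.
have -> : [set w | e < maxdist (X ^~ w) (N w) delta] =
    \bigcup_m (N @^-1` [set m] `&`
      \bigcup_(j in [set j : nat | `|m%:R - j%:R| <= m%:R * delta])
        [set w | e < mdist (X j w) (X m w)]).
  apply/seteqP; split=> w /=.
    have [j hj ->] := maxdist_attained (X ^~ w) (N w) delta0.
    by move=> lt_e; exists (N w) => //; split=> //; exists j.
  move=> [m _ [/= -> [j /= hj lt_e]]].
  exact: lt_le_trans lt_e (maxdist_ub (X ^~ w) hj).
apply: bigcup_measurable => m _; apply: measurableI => //.
by apply: bigcup_measurable => j _; exact: mdist_gt_measurable.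
Qed.

Lemma truncn_preimage_measurable d (T : measurableType d) (R : realType)
    (f : T -> R) (m : nat) :
  measurable_fun setT f -> (forall w, 0 <= f w) ->
  measurable ((fun w => Num.truncn (f w)) @^-1` [set m]).
Proof.
move=> mf f0; rewrite (_ : _ @^-1` _ = f @^-1` `[m%:R, m.+1%:R[).
  by rewrite -[_ @^-1` _]setTI; exact: mf.
apply/seteqP; split=> w /=; rewrite in_itv/=.
  by move=> /eqP; rewrite truncn_eq.
by move=> /truncn_def.
Qed.

(** * Comparison of windows at nearby indices *)

(* Indices in the window of [m] at scale [t] are, like [m] itself, in the window
   of [l] at scale [delta], because [(1 + t) ^ 2 - 1 <= delta / 2]. *)
Lemma maxdist_truncn_le (R : realType) (S : metricType R) (x : nat -> S)
    (a b t delta : R) :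
  0 < t -> t <= 1 -> 6 * t <= delta -> 8 <= (Num.truncn a)%:R * delta ->
  0 <= a -> a <= b -> b < a * (1 + t) ->
  maxdist x (Num.truncn b) t <= 2 * maxdist x (Num.truncn a) delta.
Proof.
move=> t0 t1 td ld a0 ab ba.
have := truncn_itv a0; have := truncn_itv (le_trans a0 ab).
set l := Num.truncn a in ld *; set m := Num.truncn b => /andP[mb _] /andP[la al].
have lm : l%:R <= m%:R :> R by rewrite ler_nat; exact: le_truncn.
rewrite -natr1 in al.
have l0 : 0 <= l%:R :> R by [].
have [[M ME] [L LE]] : (exists M : R, m%:R = M) /\ (exists L : R, l%:R = L).
  by split; [exists m%:R|exists l%:R].
rewrite ME LE in mb la al lm l0 ld.
have M1 : M <= (L + 1) * (1 + t) by nra.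
have Lt : L * (6 * t) <= L * delta by nra.
(* Above, $j \le (l+1)(1+t)^2 \le l + 3lt + 4$, where $3lt \le l\delta/2$ and the rounding error $4$
   is at most $l\delta/2$ by [ld]. Below, $j \ge m(1-t) \ge l(1-t)$. *)
have close j : `|m%:R - j%:R| <= m%:R * t -> `|l%:R - j%:R| <= l%:R * delta.
  rewrite ME LE !ler_norml => /andP[j1 j2].
  have := ler_wpM2r (ltW t0) M1.
  have tt : t * t <= t by nra.
  have Ltt : L * (t * t) <= L * t by nra.
  move=> M2; apply/andP; split; nra.
have [j hj ->] := maxdist_attained x m t0.
have mm : `|m%:R - m%:R| <= m%:R * t by rewrite subrr normr0 ME; nra.
(* Both [j] and [m] lie in the window of [l]; passing through [x l] costs the factor 2. *)
have := metric_triangle (x j) (x l) (x m); rewrite (metric_sym (x l)).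
have := maxdist_ub x (close _ hj); have := maxdist_ub x (close _ mm); lra.
Qed.

Lemma near_truncn_mul_ge8 (R : realType) (delta : R)
    (k : nat -> R) (u : R) :
  k n @[n --> \oo] --> +oo -> 0 < delta -> 0 < u ->
  \forall n \near \oo, 8 <= (Num.truncn (k n * u))%:R * delta.
Proof.
move=> kinf delta0 u0.
apply: (@near_truncn_scaled _ _ _ (fun l => 8 <= l%:R * delta)) kinf u0 _.
have := @cvgr_idn R; move=> /cvgryPge/(_ (8 / delta)).
by apply: filterS => l; rewrite ler_pdivrMr.
Qed.

(** * Bounds through a countable cover *)

Section countable_cover.
Context d (T : measurableType d) (R : realType) (P : probability T R).
Variables (H : nat -> set T).
Hypothesis mH : forall i, measurable (H i).

(** Continuity from below along the increasing finite unions. *)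
Lemma cover_tail_le (eta : R) : 0 < eta -> P (\bigcup_i H i) = 1%E ->
  exists N, (P (~` \big[setU/set0]_(i < N) H i) <= eta%:E)%E.
Proof.
move=> eta0 PH.
have mU n : measurable (\big[setU/set0]_(i < n) H i).
  exact: bigsetU_measurable.
have UE : \bigcup_n \big[setU/set0]_(i < n) H i = \bigcup_i H i.
  apply/seteqP; split=> [w [n _]|w [i _ Hi]].
    by rewrite -bigcup_mkord => -[i _ Hi]; exists i.
  by exists i.+1 => //; rewrite -bigcup_mkord; exists i => /=.
have : P (\big[setU/set0]_(i < n) H i) @[n --> \oo] --> 1%:E.
  rewrite -PH -UE; apply: nondecreasing_cvg_mu => //.
    exact: bigcup_measurable.
  by move=> m n mn; apply/subsetPset; exact: subset_bigsetU.
move=> /fine_cvg /cvgr_gt /(_ (1 - eta)).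
rewrite ltrBlDr ltrDl => /(_ eta0) [N _ /(_ N (leqnn N)) /= lt_N].
exists N; rewrite (probability_setC P (mU N)).
rewrite -(fineK (fin_num_measure P _ (mU N))) -EFinB lee_fin; lra.
Qed.

(** Only finitely many events are involved, so their eventual bounds hold simultaneously and the
    union bound applies for each large [n]. *)
Lemma limn_esup_cover_le (E : nat -> set T) (c : nat -> R) (N : nat) (eta : R) :
  (forall n, measurable (E n)) ->
  (P (~` \big[setU/set0]_(i < N) H i) <= eta%:E)%E ->
  (forall i, (i < N)%N -> \forall n \near \oo, (P (E n `&` H i) <= (c i)%:E)%E) ->
  (limn_esup (fun n => P (E n)) <= (eta + \sum_(i < N) c i)%:E)%E.
Proof.
move=> mE PHN Pc; apply: limn_esup_le_near.
have : \forall n \near \oo, forall i : 'I_N, (P (E n `&` H i) <= (c i)%:E)%E.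
  by apply: filter_forall => i; exact: Pc.
apply: filterS => n Pn.
have mU : measurable (\big[setU/set0]_(i < N) H i) by exact: bigsetU_measurable.
have -> : E n = (E n `&` ~` \big[setU/set0]_(i < N) H i) `|`
                (E n `&` \big[setU/set0]_(i < N) H i).
  by rewrite -setIUr setUC setUv setIT.
rewrite EFinD; apply: le_trans (measureU2 _ _ _) _.
- by apply: measurableI => //; exact: measurableC.
- exact: measurableI.
apply: leeD.
  apply: le_trans PHN; apply: le_measure; rewrite ?inE//.
  - by apply: measurableI => //; exact: measurableC.
  - exact: measurableC.
rewrite -bigcup_mkord setI_bigcupr bigcup_mkord.
apply: (@le_trans _ _ (\sum_(i < N) P (E n `&` H i))%E).
  apply: (@Boole_inequality _ _ _ P (fun i => E n `&` H i)) => i _.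
  exact: measurableI.
by rewrite -sumEFin; apply: lee_sum => i _; exact: Pn.
Qed.

End countable_cover.

Lemma ereal_inf_limn_esup_eq0 (R : realType) (v : R -> nat -> \bar R) :
  (forall delta n, (0 <= v delta n)%E) ->
  (forall eta, 0 < eta -> exists2 delta, 0 < delta &
     (limn_esup (v delta) <= eta%:E)%E) ->
  ereal_inf [set limn_esup (v delta) | delta in [set delta : R | 0 < delta]] = 0%E.
Proof.
move=> v0 small; apply/eqP; rewrite eq_le; apply/andP; split.
  apply/lee_addgt0Pr => eta /small [delta delta0 le_eta]; rewrite add0e.
  by apply: ge_ereal_inf; exists (limn_esup (v delta)) => //; exists delta.
apply: le_ereal_inf_tmp => _ [delta _ <-].
exact: limf_esup_ge0.
Qed.

(** * The random index under each alternative *)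

Section random_index.
Context d (Omega : measurableType d) (R : realType) (P : probability Omega R).
Variables (S : metricType R) (X : nat -> Omega -> S) (k : nat -> R) (U : Omega -> R).
Hypotheses (hS : separable_space S) (hX : forall n, borel_measurable (X n)).
Hypotheses (hk0 : forall n, 0 < k n) (hk : k n @[n --> \oo] --> +oo).
Hypotheses (mU : measurable_fun setT U) (hU0 : forall w, 0 < U w).

Let maxdist_const_measurable (m : nat) (eps delta : R) : 0 < delta ->
  measurable [set w | eps < maxdist (X ^~ w) m delta].
Proof.
move=> delta0; apply: (@maxdist_gt_measurable _ _ _ _ X (fun=> m)) => // j.
by rewrite preimage_cst; case: ifP.
Qed.

Let maxdist_random_measurable (n : nat) (eps delta : R) : 0 < delta ->
  measurable [set w | eps < maxdist (X ^~ w) (Num.truncn (k n * U w)) delta].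
Proof.
move=> delta0; apply: (@maxdist_gt_measurable _ _ _ _ X
  (fun w => Num.truncn (k n * U w))) => // m.
apply: (@truncn_preimage_measurable _ _ _ (fun w => k n * U w)).
  exact: measurable_realfun.measurable_funM.
by move=> w; rewrite mulr_ge0// ltW.
Qed.

Lemma maxdist_discrete_index_small (eps eta : R) :
  discrete_rv P U ->
  ereal_inf [set limn_esup
    (fun n => P [set w | eps < maxdist (X ^~ w) n delta])
    | delta in [set delta : R | 0 < delta]] = 0%E ->
  0 < eta ->
  exists2 delta : R, 0 < delta &
    (limn_esup (fun n => P [set w | (eps < maxdist (X ^~ w)
       (Num.truncn (k n * U w)) delta)%R]) <= eta%:E)%E.
Proof.
move=> [C [/countable_range [c Cc] [A [mA PA CA]]]] inf0 eta0.
pose H i := U @^-1` [set c i].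
have mH i : measurable (H i) by rewrite -[H i]setTI; exact: mU.
have PH : P (\bigcup_i H i) = 1%E.
  apply/eqP; rewrite eq_le probability_le1 ?andTb; last exact: bigcup_measurable.
  have <- : P (~` A) = 1%E by rewrite probability_setC// PA sube0.
  apply: le_measure; rewrite ?inE; [exact: measurableC|exact: bigcup_measurable|].
  move=> w Aw; have /Cc [i _ ciU] : C (U w) by apply: contrapT => /CA.
  by exists i.
have [N tailN] : exists N, (P (~` \big[setU/set0]_(i < N) H i) <= (eta / 2)%:E)%E.
  by apply: cover_tail_le => //; lra.
(* Each of the [N] atoms gets an equal share of [eta / 2]; dividing by [N.+1] covers the case
   [N = 0]. *)
pose b : R := eta / 2 / N.+1%:R.
have b0 : 0 < b by rewrite !divr_gt0.
(* [N] is fixed before [delta], so a single [delta] with limsup below [b] serves all the atoms. *)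
have : (ereal_inf [set limn_esup
    (fun n => P [set w | (eps < maxdist (X ^~ w) n delta)%R])
    | delta in [set delta : R | (0 < delta)%R]] < b%:E)%E by rewrite inf0 lte_fin.
move=> /ereal_inf_lt [_ [delta delta0 <-] /limn_esup_lt_near nearP].
exists delta => //.
apply: (@le_trans _ _ (eta / 2 + \sum_(i < N) b)%:E); last first.
  rewrite lee_fin sumr_const card_ord -mulr_natl.
  have := ler_wpM2r (ltW b0) (_ : N%:R <= N.+1%:R); rewrite ler_nat => /(_ (leqnSn N)).
  have -> : N.+1%:R * b = eta / 2 by rewrite mulrC divfK// pnatr_eq0.
  lra.
apply: (limn_esup_cover_le mH (c := fun=> b)) => // [n|i _]; first exact: maxdist_random_measurable.
(* The enumeration may contain nonpositive values; there [H i] is empty because [U] is positive. *)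
have [c0|c0] := ltP 0 (c i); last first.
  apply: nearW => n; rewrite (_ : _ `&` _ = set0) ?measure0 ?lee_fin ?ltW//.
  by rewrite -subset0 => w [_ /= Uc]; have := hU0 w; rewrite Uc ltNge c0.
apply: filterS (near_truncn_scaled hk c0 nearP) => n /ltW.
apply: le_trans; apply: le_measure; rewrite ?inE.
- by apply: measurableI => //; exact: maxdist_random_measurable.
- exact: maxdist_const_measurable.
- by move=> w [/= + Uc]; rewrite Uc.
Qed.

(* The sets [{w | r <= U w < r * (1 + t)}], [r] rational, cover [Omega]; they
   are made disjoint so that the bounds [e * P (H i)] sum up to [e]. *)
Lemma maxdist_stable_index_small (G : set (set Omega)) (eps eta : R) :
  sub_sigma_field G -> measurable_wrt G U ->
  (forall eps : R, 0 < eps -> exists delta : R, 0 < delta /\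
     forall H : set Omega, G H -> (0 < P H)%E ->
       (limn_esup (fun n =>
          cond_prob P [set w | (eps < maxdist (X ^~ w) n delta)%R] H)
        < eps%:E)%E) ->
  0 < eps -> 0 < eta ->
  exists2 delta : R, 0 < delta &
    (limn_esup (fun n => P [set w | (eps < maxdist (X ^~ w)
       (Num.truncn (k n * U w)) delta)%R]) <= eta%:E)%E.
Proof.
move=> [sG subG] mUG stable eps0 eta0.
(* [eps / 2] compensates the factor 2 in the comparison of windows; [eta / 2] bounds the total
   $\sum_i e P(H_i) \le e$. *)
pose e := Num.min (eps / 2) (eta / 2).
have e0 : 0 < e by rewrite lt_min; apply/andP; split; lra.
have [eeps eeta] : e <= eps / 2 /\ e <= eta / 2 by rewrite !ge_min !lexx orbT.
have [delta [delta0 stabled]] := stable e e0.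
(* Chosen to meet the conditions $t \le 1$ and $6t \le \delta$ of [maxdist_truncn_le]. *)
pose t := Num.min 1 (delta / 6).
have t0 : 0 < t by rewrite lt_min; apply/andP; split; lra.
have [t1 td] : t <= 1 /\ t <= delta / 6 by rewrite !ge_min !lexx orbT.
(* An enumeration of the rationals, with value 0 at codes of no rational. *)
pose r i : R := ratr (odflt 0 (unpickle i)).
pose K i : set Omega := U @^-1` `[r i, r i * (1 + t)[.
have mK i : measurable (K i : set (g_sigma_algebraType G)).
  by rewrite -[K i]setTI; exact: mUG.
pose H := seqDU K.
(* The conditional bound is available only for events of [G], so the disjoint pieces must stay in
   [G]. *)
have GH i : G (H i).
  rewrite -(measurable_g_measurableTypeE sG).
  exact: (@seqDU_measurable _ (g_sigma_algebraType G)).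
have mH i : measurable (H i) by exact: subG.
have PH : P (\bigcup_i H i) = 1%E.
  rewrite -seqDU_bigcup_eq -(probability_setT P); congr (P _).
  apply/seteqP; split=> // w _.
  (* A rational $q$ strictly between $U/(1+t)$ and $U$ satisfies $q \le U < q(1+t)$. *)
  have : U w / (1 + t) < U w by rewrite ltr_pdivrMr; have := hU0 w; nra.
  move=> /rat_in_itvoo [q]; rewrite in_itv/= => /andP[q1 q2].
  exists (pickle q) => //; rewrite /K/= /r pickleK/= in_itv/=.
  by rewrite (ltW q2) -ltr_pdivrMr//; lra.
have [N tailN] : exists N, (P (~` \big[setU/set0]_(i < N) H i) <= (eta / 2)%:E)%E.
  by apply: cover_tail_le => //; lra.
exists t => //.
pose c i := e * fine (P (H i)).
apply: (@le_trans _ _ (eta / 2 + \sum_(i < N) c i)%:E); last first.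
  rewrite lee_fin -mulr_sumr.
  suff : \sum_(i < N) fine (P (H i)) <= 1 by nra.
  rewrite -lee_fin -sumEFin.
  under eq_bigr do rewrite fineK ?fin_num_measure//.
  rewrite -(@measure_bigsetU _ _ _ P H)//; last exact: trivIset_seqDU.
  exact/probability_le1/bigsetU_measurable.
apply: (limn_esup_cover_le mH (c := c)) => // [n|i _]; first exact: maxdist_random_measurable.
have mE n : measurable [set w | eps < maxdist (X ^~ w) (Num.truncn (k n * U w)) t].
  exact: maxdist_random_measurable.
(* Conditioning requires positive probability; on a null piece the bound is immediate. *)
have [PH0|PH0] := leP (P (H i)) 0%E.
  apply: nearW => n; rewrite (@le_trans _ _ 0%E)//; last first.
    by rewrite lee_fin mulr_ge0 ?fine_ge0// ltW.
  apply: le_trans PH0; apply: le_measure; rewrite ?inE//.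
  exact: measurableI.
(* If [r i <= 0], then [r i * (1 + t) <= 0 < U], so [H i] would be empty, against [PH0]. *)
have [r0|r0] := ltP 0 (r i); last first.
  have : H i !=set0 by apply/set0P/eqP => H0; rewrite H0 measure0 ltxx in PH0.
  move=> [w Hw]; have := subset_seqDU Hw; rewrite /K/= in_itv/= => /andP[_ Ur].
  have := hU0 w; have : r i * (1 + t) <= 0 by nra.
  by lra.
have [fP0 PE] : 0 < fine (P (H i)) /\ P (H i) = (fine (P (H i)))%:E.
  by rewrite fineK ?fin_num_measure// fine_gt0// PH0 ltey_eq fin_num_measure.
have near1 := near_truncn_scaled hk r0 (limn_esup_lt_near (stabled _ (GH i) PH0)).
apply: filterS2 near1 (near_truncn_mul_ge8 hk delta0 r0) => n.
rewrite /cond_prob PE inver gt_eqF// lte_pdivrMr// => /ltW lt_e large.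
rewrite /c EFinM; apply: le_trans lt_e; apply: le_measure; rewrite ?inE.
- exact: measurableI.
- by apply: measurableI => //; exact: maxdist_const_measurable.
move=> w [/= lt_eps Hw]; split=> //=.
have := subset_seqDU Hw; rewrite /K/= in_itv/= => /andP[rU Ur].
have kn := hk0 n.
have : maxdist (X ^~ w) (Num.truncn (k n * U w)) t <=
       2 * maxdist (X ^~ w) (Num.truncn (k n * r i)) delta.
  apply: maxdist_truncn_le => //; first lra.
  - by rewrite mulr_ge0// ltW.
  - by rewrite ler_pM2l.
  - by rewrite -mulrA ltr_pM2l.
lra.
Qed.

End random_index.

(** * Conclusion from the two alternatives *)

Unset Implicit Arguments.
Set Strict Implicit.

Theorem theorem3 (R : realType) (d : measure_display) (Omega : measurableType d)
    (P : probability Omega R) (G : set (set Omega)) (hG : sub_sigma_field G)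
    (S : metricType R) (hS : separable_space S)
    (X : nat -> Omega -> S) (hX : forall n, borel_measurable (X n))
    (k : nat -> R) (hk0 : forall n, 0 < k n) (hk : k n @[n --> \oo] --> +oo)
    (U : Omega -> R) (hU : measurable_wrt G U) (hU0 : forall w, 0 < U w) :
  (discrete_rv P U /\
   forall eps : R, 0 < eps ->
     ereal_inf [set limn_esup
        (fun n => P [set w | eps < maxdist (X ^~ w) n delta])
        | delta in [set delta : R | 0 < delta]] = 0%E) \/
  (forall eps : R, 0 < eps -> exists delta : R, 0 < delta /\
     forall H : set Omega, G H -> (0 < P H)%E ->
       (limn_esup (fun n =>
          cond_prob P [set w | (eps < maxdist (X ^~ w) n delta)%R] H)
        < eps%:E)%E) ->
  forall eps : R, 0 < eps ->
    ereal_inf [set limn_esup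
       (fun n => P [set w | eps < maxdist (X ^~ w)
                                    (Num.truncn (k n * U w)) delta])
       | delta in [set delta : R | 0 < delta]] = 0%E.
Proof.
(* [G] is contained in the ambient sigma-field, so [U] is a random variable on [Omega]. *)
have mU : measurable_fun setT U.
  move=> mT B mB; apply: (hG.2).
  by rewrite -(measurable_g_measurableTypeE hG.1); exact: hU.
move=> hyp eps eps0; apply: ereal_inf_limn_esup_eq0 => // eta eta0.
case: hyp => [[dU inf0]|stable].
  exact: maxdist_discrete_index_small (inf0 _ eps0) _.
exact: maxdist_stable_index_small stable _ _.
Qed.
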